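(* Let $(p_1,\alpha^1,\beta^1)$ and $(p_2,\alpha^2,\beta^2)$ be two equilibria, with demand and supply maps $D_1,S_1$ (for $p_1$) and $D_2,S_2$ (for $p_2$), and conditional probabilities $P^1_x,P^1_y$ and $P^2_x,P^2_y$. Then $P^2_x[D_1(x)]=P^1_x[D_1(x)]=1$ for $\mu$-almost every $x\in X$, and $P^2_y[S_1(y)]=P^1_y[S_1(y)]=1$ for $\nu$-almost every $y\in Y$.
   Context: Standing setting. $X\subset\mathbb R^{d_1}$, $Y\subset\mathbb R^{d_2}$, $Z_0\subset\mathbb R^{d_3}$ are compact sets (possibly finite). $\mu$ and $\nu$ are finite nonnegative Borel measures on $X$ and $Y$. $u$ is a continuous real function on a neighbourhood of $X\times Z_0$, differentiable in $x$ with $D_xu$ continuous; $v$ is a continuous real function on a neighbourhood of $Y\times Z_0$, differentiable in $y$ with $D_yv$ continuous. Let $\varnothing_d\neq\varnothing_s$ be two points not in $Z_0$ and $Z=Z_0\cup\{\varnothing_d\}\cup\{\varnothing_s\}$ (the added points isolated). Extend $u,v$ by $u(x,\varnothing_d)=0$, $u(x,\varnothing_s)=-1$, $v(y,\varnothing_s)=0$, $v(y,\varnothing_d)=1$. Define $b(z)=\max_{x}u(x,z)$, $a(z)=\min_{y}v(y,z)$, $Z_1=\{z\in Z: a(z)\le b(z)\}$. A price system is a continuous $p:Z\to\mathbb R$ with $p(\varnothing_d)=p(\varnothing_s)=0$; admissible if $a\le p\le b$ on $Z_1$. Given $p$: $D(x)=\arg\max_{z\in Z}\{u(x,z)-p(z)\}$,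 $S(y)=\arg\min_{z\in Z}\{v(y,z)-p(z)\}$. A demand distribution associated with $p$ is a positive Borel measure $\alpha$ on $X\times Z$ carried by the graph of $D$ with $X$-marginal $\mu$; a supply distribution is a positive Borel measure $\beta$ on $Y\times Z$ carried by the graph of $S$ with $Y$-marginal $\nu$. The conditional probabilities $(P^\alpha_x)_{x\in X}$ are the Borel probabilities on $Z$ disintegrating $\alpha$ with respect to $\mu$: $\int f\,d\alpha=\int_X\int_Z f(x,z)\,dP^\alpha_x(z)\,d\mu(x)$ for continuous $f$; similarly $(P^\beta_y)$ for $\beta$ with respect to $\nu$. An equilibrium is a triple $(p,\alpha,\beta)$ with $p$ admissible, $\alpha,\beta$ demand and supply distributions associated with $p$, and $\alpha_Z(A)=\beta_Z(A)$ for every Borel $A\subset Z_0$ ($\alpha_Z,\beta_Z$ the $Z$-marginals). For equilibrium $i$, $P^i_x:=P^{\alpha^i}_x$, $P^i_y:=P^{\beta^i}_y$. *)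

(* Defs.v *)
From HB Require Import structures.
From mathcomp Require Import all_boot all_order all_algebra.
From mathcomp Require Import all_classical all_reals all_analysis.
From mathcomp Require Import measurable_realfun.
Set Implicit Arguments.
Unset Strict Implicit.
Unset Printing Implicit Defensive.
Import Order.TTheory GRing.Theory Num.Theory.
Import numFieldNormedType.Exports.
Local Open Scope classical_set_scope.
Local Open Scope ring_scope.

Definition BV (R : realType) (n : nat) :=
  g_sigma_algebraType (@open 'rV[R]_n).

(* The ambient type of the space of goods Z = Z0 u {empty_d} u {empty_s}:
   [inl z] is the point z of R^d3, [inr true] is empty_d and [inr false]
   is empty_s.  The two added points are isolated. *)
Definition ZT (R : realType) (n : nat) := ('rV[R]_n + bool)%type.
HB.instance Definition _ (R : realType) (n : nat) :=
  Choice.copy (ZT R n) ('rV[R]_n + bool)%type.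
HB.instance Definition _ (R : realType) (n : nat) :=
  isPointed.Build (ZT R n) (inr true).
Definition empty_d {R : realType} {n : nat} : ZT R n := inr true.
Definition empty_s {R : realType} {n : nat} : ZT R n := inr false.

(* generators of the Borel sigma-algebra of the disjoint-union topology *)
Definition ZGen (R : realType) (n : nat) : set (set (ZT R n)) :=
  [set A | (exists2 U : set 'rV[R]_n, open U & A = inl @` U)
           \/ (exists b : bool, A = [set inr b])].
Definition BZ (R : realType) (n : nat) := g_sigma_algebraType (@ZGen R n).

Definition Zset (R : realType) (n : nat) (Z0 : set 'rV[R]_n) : set (ZT R n) :=
  [set z | match z with inl z0 => Z0 z0 | inr _ => True end].

Definition uZ (R : realType) (d1 d3 : nat) (u : 'rV[R]_d1 -> 'rV[R]_d3 -> R)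
  (x : 'rV[R]_d1) (z : ZT R d3) : R :=
  match z with inl z0 => u x z0 | inr true => 0 | inr false => -1 end.
Definition vZ (R : realType) (d2 d3 : nat) (v : 'rV[R]_d2 -> 'rV[R]_d3 -> R)
  (y : 'rV[R]_d2) (z : ZT R d3) : R :=
  match z with inl z0 => v y z0 | inr true => 1 | inr false => 0 end.

(* b(z) = max_{x in X} u(x,z), a(z) = min_{y in Y} v(y,z)
   (written as sup/inf in the extended reals; for nonempty compact X, Y
   these are attained, i.e. they are the max/min) *)
Definition bfun (R : realType) (d1 d3 : nat) (X : set 'rV[R]_d1)
  (u : 'rV[R]_d1 -> 'rV[R]_d3 -> R) (z : ZT R d3) : \bar R :=
  ereal_sup [set (uZ u x z)%:E | x in X].
Definition afun (R : realType) (d2 d3 : nat) (Y : set 'rV[R]_d2)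
  (v : 'rV[R]_d2 -> 'rV[R]_d3 -> R) (z : ZT R d3) : \bar R :=
  ereal_inf [set (vZ v y z)%:E | y in Y].

Definition Z1 (R : realType) (d1 d2 d3 : nat) (X : set 'rV[R]_d1)
  (Y : set 'rV[R]_d2) (Z0 : set 'rV[R]_d3)
  (u : 'rV[R]_d1 -> 'rV[R]_d3 -> R) (v : 'rV[R]_d2 -> 'rV[R]_d3 -> R) :
  set (ZT R d3) :=
  [set z | Zset Z0 z /\ (afun Y v z <= bfun X u z)%E].

Definition price_system (R : realType) (d3 : nat) (Z0 : set 'rV[R]_d3)
  (p : ZT R d3 -> R) : Prop :=
  {within Z0, continuous (fun z0 => p (inl z0))} /\
  p empty_d = 0 /\ p empty_s = 0.

Definition admissible (R : realType) (d1 d2 d3 : nat) (X : set 'rV[R]_d1)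
  (Y : set 'rV[R]_d2) (Z0 : set 'rV[R]_d3)
  (u : 'rV[R]_d1 -> 'rV[R]_d3 -> R) (v : 'rV[R]_d2 -> 'rV[R]_d3 -> R)
  (p : ZT R d3 -> R) : Prop :=
  price_system Z0 p /\
  forall z, Z1 X Y Z0 u v z ->
    (afun Y v z <= (p z)%:E)%E /\ ((p z)%:E <= bfun X u z)%E.

Definition Dmap (R : realType) (d1 d3 : nat) (Z0 : set 'rV[R]_d3)
  (u : 'rV[R]_d1 -> 'rV[R]_d3 -> R) (p : ZT R d3 -> R) (x : 'rV[R]_d1) :
  set (ZT R d3) :=
  [set z | Zset Z0 z /\
     forall z', Zset Z0 z' -> uZ u x z' - p z' <= uZ u x z - p z].
Definition Smap (R : realType) (d2 d3 : nat) (Z0 : set 'rV[R]_d3)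
  (v : 'rV[R]_d2 -> 'rV[R]_d3 -> R) (p : ZT R d3 -> R) (y : 'rV[R]_d2) :
  set (ZT R d3) :=
  [set z | Zset Z0 z /\
     forall z', Zset Z0 z' -> vZ v y z - p z <= vZ v y z' - p z'].

Definition carried_by (d : measure_display) (T : measurableType d)
  (R : realType) (m : {measure set T -> \bar R}) (G : set T) : Prop :=
  exists2 A : set T, measurable A & A `<=` G /\ m (~` A) = 0%E.

Definition assoc_distribution (R : realType) (n d3 : nat) (W : set 'rV[R]_n)
  (F : 'rV[R]_n -> set (ZT R d3)) (m : {measure set (BV R n) -> \bar R})
  (al : {measure set (BV R n * BZ R d3)%type -> \bar R}) : Prop :=
  carried_by al [set q | W q.1 /\ F q.1 q.2] /\
  forall B : set (BV R n), measurable B -> al (B `*` setT) = m B.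

Definition equilibrium (R : realType) (d1 d2 d3 : nat) (X : set 'rV[R]_d1)
  (Y : set 'rV[R]_d2) (Z0 : set 'rV[R]_d3)
  (u : 'rV[R]_d1 -> 'rV[R]_d3 -> R) (v : 'rV[R]_d2 -> 'rV[R]_d3 -> R)
  (mu : {measure set (BV R d1) -> \bar R})
  (nu : {measure set (BV R d2) -> \bar R})
  (p : ZT R d3 -> R)
  (al : {measure set (BV R d1 * BZ R d3)%type -> \bar R})
  (be : {measure set (BV R d2 * BZ R d3)%type -> \bar R}) : Prop :=
  [/\ admissible X Y Z0 u v p,
      assoc_distribution X (Dmap Z0 u p) mu al,
      assoc_distribution Y (Smap Z0 v p) nu be &
      forall A : set (BZ R d3), measurable A -> A `<=` inl @` Z0 ->
        al (setT `*` A) = be (setT `*` A)].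

Definition continuous_on_WZ (R : realType) (n d3 : nat) (W : set 'rV[R]_n)
  (Z0 : set 'rV[R]_d3) (f : 'rV[R]_n -> ZT R d3 -> R) : Prop :=
  {within W `*` Z0, continuous (fun q : 'rV[R]_n * 'rV[R]_d3 => f q.1 (inl q.2))}
  /\ forall b : bool, {within W, continuous (fun x => f x (inr b))}.

Definition disintegration (R : realType) (n d3 : nat) (W : set 'rV[R]_n)
  (Z0 : set 'rV[R]_d3) (m : {measure set (BV R n) -> \bar R})
  (al : {measure set (BV R n * BZ R d3)%type -> \bar R})
  (P : 'rV[R]_n -> {measure set (BZ R d3) -> \bar R}) : Prop :=
  [/\ (forall w, W w -> P w setT = 1%E /\ P w (~` Zset Z0) = 0%E),
      (forall A : set (BZ R d3), measurable A ->
         measurable_fun (W : set (BV R n)) (fun w => P w A)) &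
      (forall f : 'rV[R]_n -> ZT R d3 -> R, continuous_on_WZ W Z0 f ->
         (\int[al]_(q in (W `*` Zset Z0 : set (BV R n * BZ R d3)%type))
             (f q.1 q.2)%:E
          = \int[m]_(w in (W : set (BV R n)))
              \int[P w]_(z in (Zset Z0 : set (BZ R d3))) (f w z)%:E)%E)].

Definition finite_measure_on (R : realType) (n : nat) (W : set 'rV[R]_n)
  (m : {measure set (BV R n) -> \bar R}) : Prop :=
  (m setT < +oo)%E /\ m (~` (W : set (BV R n))) = 0%E.

Definition regular_utility (R : realType) (n d3 : nat) (W : set 'rV[R]_n)
  (Z0 : set 'rV[R]_d3) (w : 'rV[R]_n -> 'rV[R]_d3 -> R) : Prop :=
  exists O : set ('rV[R]_n * 'rV[R]_d3),
    [/\ open O, W `*` Z0 `<=` O,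
        {within O, continuous (fun q : 'rV[R]_n * 'rV[R]_d3 => w q.1 q.2)},
        (forall q : 'rV[R]_n * 'rV[R]_d3, O q ->
           differentiable (fun x : 'rV[R]_n => w x q.2) (q.1)) &
        (forall h : 'rV[R]_n,
           {within O, continuous (fun q : 'rV[R]_n * 'rV[R]_d3 =>
              'd (fun x : 'rV[R]_n => w x q.2) (q.1) h)})].

Definition standing_setting (R : realType) (d1 d2 d3 : nat)
  (X : set 'rV[R]_d1) (Y : set 'rV[R]_d2) (Z0 : set 'rV[R]_d3)
  (mu : {measure set (BV R d1) -> \bar R})
  (nu : {measure set (BV R d2) -> \bar R})
  (u : 'rV[R]_d1 -> 'rV[R]_d3 -> R) (v : 'rV[R]_d2 -> 'rV[R]_d3 -> R) : Prop :=
  [/\ compact X /\ compact Y /\ compact Z0,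
      finite_measure_on X mu, finite_measure_on Y nu,
      regular_utility X Z0 u & regular_utility Y Z0 v].

(* Main.v *)
(* The total surplus [\int u dalpha - \int v dbeta] of the allocation of any
   equilibrium is bounded by [\int phi dmu - \int psi dnu] for any price system
   p, where phi x = max_z (u - p) and psi y = min_z (v - p): market clearing on
   Z0 and the vanishing of p at the two empty goods cancel the prices.  For its
   own prices every equilibrium attains its bound, so, comparing two equilibria
   both ways, the second one also attains the bound given by p1.  The
   nonnegative continuous gaps phi - (u - p1) and (v - p1) - psi thus have
   integral 0 for al2 and be2, and the disintegration turns this into an almost
   sure statement on P2x and P2y.  Sellers are treated as buyers with utility
   - v facing the prices - p. *)
Require Import Defs.
From HB Require Import structures.
From mathcomp Require Import all_boot all_order all_algebra.
From mathcomp Require Import all_classical all_reals all_analysis.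
From mathcomp Require Import measurable_realfun.
From mathcomp Require Import lra.
Import Order.TTheory GRing.Theory Num.Theory.
Import numFieldNormedType.Exports.
Local Open Scope classical_set_scope.
Local Open Scope ring_scope.

Set Implicit Arguments.
Unset Strict Implicit.
Unset Printing Implicit Defensive.

(** * Borel sets of R^n and of the space of goods *)

Section Borel_sets.
Context {R : realType}.

Lemma ball_ratr_exists (n : nat) (x : 'rV[R]_n) (e : R) : 0 < e ->
  exists q : 'rV[rat]_n, ball (map_mx ratr q : 'rV[R]_n) e x.
Proof.
move=> e0; have /choice[f fP] (i : 'I_n) : exists q : rat, ball (ratr q : R) e (x 0 i).
  have /rat_in_itvoo[q /itvP qxe] : x 0 i < x 0 i + e by rewrite ltrDl.
  exists q; rewrite /ball /= ger0_norm ?subr_ge0 ?ltW ?qxe//.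
  by rewrite ltrBlDl qxe.
exists (\row_j f j); split=> // i j; rewrite !mxE (ord1 i); exact: fP.
Qed.

(** These balls form a countable base of the topology of R^n. *)
Definition ratr_ball (n : nat) (q : 'rV[rat]_n) (k : nat) : set 'rV[R]_n :=
  ball (map_mx ratr q : 'rV[R]_n) k.+1%:R^-1.

Lemma open_ratr_ball (n : nat) (q : 'rV[rat]_n) k : open (ratr_ball q k).
Proof. by apply: ball_open; rewrite invr_gt0. Qed.

Lemma open_prod_ratr_ball (n m : nat) (O : set ('rV[R]_n * 'rV[R]_m)) x z :
  open O -> O (x, z) ->
  exists t : 'rV[rat]_n * 'rV[rat]_m * nat,
    [/\ ratr_ball t.1.1 t.2 x, ratr_ball t.1.2 t.2 z &
        ratr_ball t.1.1 t.2 `*` ratr_ball t.1.2 t.2 `<=` O].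
Proof.
move=> oO Oxz.
have /nbhs_ballP[e /= e0 eO] : nbhs (x, z) O by apply: open_nbhs_nbhs.
(* A ball of radius 1/(k+1) that contains [x] lies within twice that radius of [x], whatever its
   centre. *)
have [k ke] : exists k : nat, k.+1%:R^-1 + k.+1%:R^-1 < e.
  have e20 : 0 < e / 2 by rewrite divr_gt0.
  have [k _ kP] := near_infty_natSinv_lt (PosNum e20).
  have ke : k.+1%:R^-1 < e / 2 by exact: kP k (leqnn _).
  by exists k; rewrite [ltRHS]splitr ltrD.
have k0 : (0 : R) < k.+1%:R^-1 by rewrite invr_gt0.
have [q1 q1x] := ball_ratr_exists x k0; have [q2 q2z] := ball_ratr_exists z k0.
exists (q1, q2, k); split=> // -[x' z'] /= [q1x' q2z']; apply: eO; split => /=.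
  by apply: (le_ball (ltW ke)); apply: (ball_triangle _ q1x'); exact: ball_sym.
by apply: (le_ball (ltW ke)); apply: (ball_triangle _ q2z'); exact: ball_sym.
Qed.

Lemma open_measurableBV (n : nat) (U : set 'rV[R]_n) :
  open U -> measurable (U : set (BV R n)).
Proof. exact: sub_sigma_algebra. Qed.

Lemma open_measurableBZ (n : nat) (U : set 'rV[R]_n) :
  open U -> measurable (inl @` U : set (BZ R n)).
Proof. by move=> oU; apply: sub_sigma_algebra; left; exists U. Qed.

Lemma measurable_inr (n : nat) (b : bool) : measurable ([set inr b] : set (BZ R n)).
Proof. by apply: sub_sigma_algebra; right; exists b. Qed.

Lemma compact_measurableBV (n : nat) (W : set 'rV[R]_n) :
  compact W -> measurable (W : set (BV R n)).
Proof.
move=> /(compact_closed (@norm_hausdorff _ _)) /closed_openC /open_measurableBV.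
by move=> /measurableC; rewrite setCK.
Qed.

Lemma ZsetE (n : nat) (Z0 : set 'rV[R]_n) :
  Zset Z0 = inl @` Z0 `|` [set inr true] `|` [set inr false].
Proof.
apply/seteqP; split=> [[z|[]] /=|z [[[z0 ? <-]|->]|->]] //=.
- by left; left; exists z.
- by left; right.
- by right.
Qed.

(** Both empty goods lie in [Zset Z0], so its complement is the [inl] image of the open complement
    of [Z0], a generator of the sigma-algebra. *)
Lemma compact_measurable_Zset (n : nat) (Z0 : set 'rV[R]_n) :
  compact Z0 -> measurable (Zset Z0 : set (BZ R n)).
Proof.
move=> /(compact_closed (@norm_hausdorff _ _)) /closed_openC /open_measurableBZ.
move=> /measurableC; congr (measurable _); apply/seteqP; split=> [[z|b]|[z|b]] //=.
- by move=> nz; apply: contrapT => Zz; apply: nz; exists z.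
- by move=> Zz [z' nz' [zz']]; apply: nz'; rewrite zz'.
- by move=> _ [].
Qed.

Lemma compact_measurable_inl (n : nat) (Z0 : set 'rV[R]_n) :
  compact Z0 -> measurable (inl @` Z0 : set (BZ R n)).
Proof.
move=> /compact_measurable_Zset mZ.
have -> : inl @` Z0 = (Zset Z0 : set (BZ R n)) `\` [set inr true] `\` [set inr false].
  apply/seteqP; split=> [z [z0 Zz <-]|[z|[]] [[Zz nt] nf]] //=.
  - by exists z.
  - by case: nt.
  - by case: nf.
apply: measurableD; last exact: measurable_inr.
by apply: measurableD; last exact: measurable_inr.
Qed.

(* Second countability, through balls with rational centres, is what makes open
   sets of the product measurable for the product sigma-algebra. *)
Lemma open_measurable_prod_inl (n m : nat) (O : set ('rV[R]_n * 'rV[R]_m)) :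
  open O ->
  measurable [set q : BV R n * BZ R m | exists2 z, q.2 = inl z & O (q.1, z)].
Proof.
move=> oO.
pose B (t : 'rV[rat]_n * 'rV[rat]_m * nat) : set (BV R n * BZ R m) :=
  if `[< ratr_ball t.1.1 t.2 `*` ratr_ball t.1.2 t.2 `<=` O >]
  then (ratr_ball t.1.1 t.2 : set (BV R n))
    `*` (inl @` ratr_ball t.1.2 t.2 : set (BZ R m))
  else set0.
have -> : [set q : BV R n * BZ R m | exists2 z, q.2 = inl z & O (q.1, z)] =
    \bigcup_t B t.
  apply/seteqP; split=> -[x z] /=.
    move=> [z0 -> /(open_prod_ratr_ball oO)[t [xt zt tO]]].
    by exists t => //; rewrite /B asboolT//; split => //; exists z0.
  move=> [t _]; rewrite /B; case: asboolP => // tO [/= xt [z0 zt <-]].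
  by exists z0 => //; exact: tO.
apply: countable_bigcupT_measurable => // t; rewrite /B; case: ifPn => // _.
apply: measurableX; first by apply: open_measurableBV; exact: open_ratr_ball.
by apply: open_measurableBZ; exact: open_ratr_ball.
Qed.

End Borel_sets.

(** * Functions continuous on W x Z and their measurability *)

Lemma within_continuous_cvg {T S : topologicalType} {A : set T} {f : T -> S} {x : T} :
  {within A, continuous f} -> A x -> f @ within A (nbhs x) --> f x.
Proof. by move=> cf; move: x; exact/(@subspace_continuousP _ _ _ f). Qed.

Section continuity_and_measurability.
Context {R : realType} (n d3 : nat) (W : set 'rV[R]_n) (Z0 : set 'rV[R]_d3).
Hypotheses (cW : compact W) (cZ0 : compact Z0).
Implicit Types F G : 'rV[R]_n -> ZT R d3 -> R.

Let E : set (BV R n * BZ R d3) := W `*` Zset Z0.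

Lemma measurable_WZ : measurable E.
Proof.
by apply: measurableX; [exact: compact_measurableBV|exact: compact_measurable_Zset].
Qed.

Lemma continuous_on_WZB F G : continuous_on_WZ W Z0 F -> continuous_on_WZ W Z0 G ->
  continuous_on_WZ W Z0 (fun w z => F w z - G w z).
Proof.
move=> [cF1 cF2] [cG1 cG2]; split=> [|b]; first exact: within_continuousB.
exact: (within_continuousB (cF2 b) (cG2 b)).
Qed.

Lemma continuous_on_WZ_fst (f : 'rV[R]_n -> R) :
  {within W, continuous f} -> continuous_on_WZ W Z0 (fun w _ => f w).
Proof.
move=> cf; split=> [|b]; last exact: cf.
apply/subspace_continuousP => -[w z] [/= Ww Zz].
apply: cvg_comp (within_continuous_cvg cf Ww).
move=> A nA; exists ([set x | W x -> A x], setT); first by split => //; exact: filterT.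
by move=> [w' z'] [/= Aw' _] [Ww' _]; exact: Aw'.
Qed.

Lemma continuous_on_WZ_snd (p : ZT R d3 -> R) :
  {within Z0, continuous (fun z => p (inl z))} -> continuous_on_WZ W Z0 (fun _ z => p z).
Proof.
move=> cf; split; last by move=> b; apply: continuous_subspaceT; exact: cst_continuous.
apply/subspace_continuousP => -[w z] [/= Ww Zz].
apply: cvg_comp (within_continuous_cvg cf Zz).
move=> A nA; exists (setT, [set x | Z0 x -> A x]); first by split => //; exact: filterT.
by move=> [w' z'] [_ /= Az'] [_ Zz']; exact: Az'.
Qed.

Lemma continuous_measurable_fun_BV (f : 'rV[R]_n -> R) :
  {within W, continuous f} -> measurable_fun (W : set (BV R n)) (f : BV R n -> R).
Proof.
move=> /continuousP cf; apply: (measurability _ (RGenOpens.measurableE R)).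
move=> _ [_ [a [b ->] <-]].
have oab := @interval_open R (BRight a) (BLeft b) isT isT.
have /open_subspaceP[V oV VE] := cf `]a, b[%classic oab.
have -> : W `&` f @^-1` `]a, b[ = V `&` W by rewrite VE setIC.
by apply: measurableI; [exact: open_measurableBV|exact: compact_measurableBV].
Qed.

(** W x Z splits into W x Z0 and two slices. On each slice [F] depends on [w] alone; on W x Z0 the
    preimage of an open interval is the trace of an open set of the product, measurable by
    [open_measurable_prod_inl]. *)
Lemma measurable_fun_WZ F : continuous_on_WZ W Z0 F ->
  measurable_fun E (fun q : BV R n * BZ R d3 => F q.1 q.2).
Proof.
have mWr b : measurable ((W : set (BV R n)) `*` ([set inr b] : set (BZ R d3))).
  by apply: measurableX; [exact: compact_measurableBV|exact: measurable_inr].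
have mWl : measurable ((W : set (BV R n)) `*` (inl @` Z0 : set (BZ R d3))).
  by apply: measurableX; [exact: compact_measurableBV|exact: compact_measurable_inl].
move=> [/continuousP cF cb].
have measurable_funWr b :
  measurable_fun ((W : set (BV R n)) `*` ([set inr b] : set (BZ R d3)))
    (fun q : BV R n * BZ R d3 => F q.1 q.2).
  apply: (eq_measurable_fun (fun q : BV R n * BZ R d3 => F q.1 (inr b))).
    by move=> -[w z] /[!inE] -[/= _ ->].
  apply: (measurable_comp (compact_measurableBV cW) _
    (continuous_measurable_fun_BV (cb b))).
    by move=> _ [q [Wq _] <-].
  exact: measurable_funTS measurable_fst.
have -> : E = (W : set (BV R n)) `*` (inl @` Z0 : set (BZ R d3))
    `|` (W : set (BV R n)) `*` ([set inr true] : set (BZ R d3))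
    `|` (W : set (BV R n)) `*` ([set inr false] : set (BZ R d3)).
  rewrite /E ZsetE; apply/seteqP; split=> -[w z] /=.
    by move=> [Ww [[?|?]|?]]; [left; left|left; right|right].
  by move=> [[[? ?]|[? ?]]|[? ?]]; split => //; [left; left|left; right|right].
apply/measurable_funU => //.
  exact: measurableU.
split; [apply/measurable_funU => //; split|].
- apply: (measurability _ (RGenOpens.measurableE R)) => _ [_ [a [b ->] <-]].
  have oab := @interval_open R (BRight a) (BLeft b) isT isT.
  have /open_subspaceP[V oV VE] := cF `]a, b[%classic oab.
  rewrite (_ : _ `&` _ = W `*` [set inl x | x in Z0] `&`
    [set q : BV R n * BZ R d3 | exists2 z, q.2 = inl z & V (q.1, z)]).
    by apply: measurableI => //; exact: open_measurable_prod_inl.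
  apply/seteqP; split=> -[w z] /= [[Ww [z0 Zz <-]]].
    move=> Fab; split; first by split=> //; exists z0.
    have : (V `&` W `*` Z0) (w, z0) by rewrite VE.
    by case=> ? _; exists z0.
  move=> [_ [<-] Vz]; split; first by split=> //; exists z0.
  have : (V `&` W `*` Z0) (w, z0) by split.
  by rewrite VE => -[].
- exact: measurable_funWr.
- exact: measurable_funWr.
Qed.

Lemma measurable_fun_sectionZ F w : continuous_on_WZ W Z0 F -> W w ->
  measurable_fun (Zset Z0 : set (BZ R d3)) (F w).
Proof.
move=> cF Ww; have mF := measurable_fun_WZ cF.
have := measurable_comp measurable_WZ _ mF
  (measurable_funTS (measurable_pair1 (w : BV R n))).
by apply=> _ [z Zz <-].
Qed.

End continuity_and_measurability.

(** * Maximal payoff over the goods *)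

Lemma compact_continuous_bounded {R : realType} {T : topologicalType} {K : set T}
  {f : T -> R} : compact K -> {within K, continuous f} ->
  exists M, forall x, K x -> `|f x| <= M.
Proof.
move=> cK cf; have /ex_strict_bound_gt0[M _ /= MP] : bounded_set (f @` K).
  exact/compact_bounded/continuous_compact.
by exists M => x Kx; apply/ltW/MP; exists x.
Qed.

Section maximum.
Context {R : realType} (n d3 : nat) (W : set 'rV[R]_n) (Z0 : set 'rV[R]_d3).
Hypotheses (cW : compact W) (cZ0 : compact Z0).
Variable F : 'rV[R]_n -> ZT R d3 -> R.
Hypothesis cF : continuous_on_WZ W Z0 F.

Lemma continuous_on_WZ_bounded :
  exists M, forall w z, W w -> Zset Z0 z -> `|F w z| <= M.
Proof.
case: cF => cl cr.
have [M0 M0P] := compact_continuous_bounded (compact_setX cW cZ0) cl.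
have [M1 M1P] := compact_continuous_bounded cW (cr true).
have [M2 M2P] := compact_continuous_bounded cW (cr false).
exists (Num.max M0 (Num.max M1 M2)) => w [z|[]] Ww Zz; rewrite !le_max.
- by rewrite (M0P (w, z)).
- by rewrite (M1P w)// orbT.
- by rewrite (M2P w)// !orbT.
Qed.

(** Common form of demand and supply: [Dmap] is [argmaxZ] of u - p by conversion, and [SmapE] brings
    [Smap] to this form. *)
Definition argmaxZ w : set (ZT R d3) :=
  [set z | Zset Z0 z /\ forall z', Zset Z0 z' -> F w z' <= F w z].

Definition supZ w : R := sup [set F w z | z in Zset Z0].

Let has_supZ w : W w -> has_sup [set F w z | z in Zset Z0].
Proof.
move=> Ww; have [M MP] := continuous_on_WZ_bounded; split.
  by exists (F w (inr true)); exists (inr true).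
by exists M => _ [z Zz <-]; exact: le_trans (ler_norm _) (MP _ _ Ww Zz).
Qed.

Lemma le_supZ w z : W w -> Zset Z0 z -> F w z <= supZ w.
Proof. by move=> Ww Zz; apply: sup_upper_bound; [exact: has_supZ|exists z]. Qed.

Lemma supZ_le w M : W w -> (forall z, Zset Z0 z -> F w z <= M) -> supZ w <= M.
Proof.
move=> Ww FM; apply: ge_sup; first by case: (has_supZ Ww).
by move=> _ [z Zz <-]; exact: FM.
Qed.

(** Optimality becomes the vanishing of a nonnegative gap, which an integral can detect. *)
Lemma argmaxZE w : W w -> argmaxZ w = [set z | Zset Z0 z /\ supZ w - F w z = 0].
Proof.
move=> Ww; apply/seteqP; split=> z [Zz zP]; split => //.
  by apply/eqP; rewrite subr_eq0 eq_le le_supZ// supZ_le.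
by move=> z' Zz'; rewrite -(subr0_eq zP) le_supZ.
Qed.

(** Compactness of [Z0] turns continuity of [F] at each (x, z) into one neighbourhood of [x] that
    serves all goods at once; the two empty goods are added separately. *)
Lemma near_dist_sectionZ x e : W x -> 0 < e ->
  \forall w \near within W (nbhs x), forall z, Zset Z0 z -> `|F x z - F w z| < e.
Proof.
move=> Wx e0; have [cl cr] := cF.
have nearr b : \forall w \near within W (nbhs x), `|F x (inr b) - F w (inr b)| < e.
  by have /cvgrPdist_lt/(_ _ e0) := within_continuous_cvg (cr b) Wx.
have nearl : \forall w \near within W (nbhs x),
    Z0 `<=` [set z | `|F x (inl z) - F w (inl z)| < e].
  move: cZ0 => /compact_near_coveringP/near_covering_withinP; apply => z Zz.
  (* Half of [e], since [F x z'] and [F w z'] are both compared with [F x z]. *)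
  have e20 : 0 < e / 2 by rewrite divr_gt0.
  have /cvgrPdist_lt/(_ _ e20) :=
    within_continuous_cvg cl (conj Wx Zz : (W `*` Z0) (x, z)).
  move=> [[B C] [/= nB nC] BC].
  exists (C, [set w | W w /\ B w]) => /=.
    by split=> //; apply: filterS nB => w Bw Ww.
  move=> [z' w] [/= Cz' [Ww Bw]] Zz'.
  have := BC (w, z') (conj Bw Cz') (conj Ww Zz').
  have := BC (x, z') (conj (nbhs_singleton nB) Cz') (conj Wx Zz').
  by rewrite /= !ltr_norml => /andP[? ?] /andP[? ?]; apply/andP; split; lra.
near=> w => -[z|b] Zz.
  by apply: (near nearl w).
by case: b Zz => _; [apply: (near (nearr true) w)|apply: (near (nearr false) w)].
Unshelve. all: by end_near. Qed.

(** Taking suprema does not increase the uniform distance between the sections [F x] and [F w],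
    which [near_dist_sectionZ] makes small. *)
Lemma continuous_supZ : {within W, continuous supZ}.
Proof.
apply/subspace_continuousP => x Wx; apply/cvgrPdist_le => e e0.
near=> w.
have Ww : W w by near: w; exact: withinT.
have dF z : Zset Z0 z -> `|F x z - F w z| < e.
  by move: z; near: w; exact: near_dist_sectionZ.
change (`|supZ x - supZ w| <= e); rewrite ler_distl; apply/andP; split; last first.
  apply: supZ_le => // z Zz; have := dF z Zz; have := le_supZ Ww Zz.
  by rewrite ltr_norml => ? /andP[? ?]; lra.
rewrite lerBlDr; apply: supZ_le => // z Zz; have := dF z Zz; have := le_supZ Wx Zz.
by rewrite ltr_norml => ? /andP[? ?]; lra.
Unshelve. all: by end_near. Qed.

Lemma continuous_on_WZ_gap : continuous_on_WZ W Z0 (fun w z => supZ w - F w z).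
Proof.
apply: continuous_on_WZB => //; apply: continuous_on_WZ_fst; exact: continuous_supZ.
Qed.

End maximum.

(** * From a zero integral to an almost sure statement on the conditional probabilities *)

Section kernel.
Local Open Scope ereal_scope.
Context {R : realType} (n d3 : nat) (W : set 'rV[R]_n) (Z0 : set 'rV[R]_d3).
Hypotheses (cW : compact W) (cZ0 : compact Z0).
Variable G : 'rV[R]_n -> ZT R d3 -> R.
Hypothesis cG : continuous_on_WZ W Z0 G.
Hypothesis G0 : forall w z, W w -> Zset Z0 z -> (0 <= G w z)%R.
Variables (m : {measure set (BV R n) -> \bar R})
  (al : {measure set (BV R n * BZ R d3)%type -> \bar R})
  (P : 'rV[R]_n -> {measure set (BZ R d3) -> \bar R}).
Hypothesis dP : disintegration W Z0 m al P.

Let E : set (BV R n * BZ R d3) := W `*` Zset Z0.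
Let k : BV R n * BZ R d3 -> \bar R := (fun q => (G q.1 q.2)%:E) \_ E.

Let mW : measurable (W : set (BV R n)). Proof. exact: compact_measurableBV. Qed.
Let mZ : measurable (Zset Z0 : set (BZ R d3)). Proof. exact: compact_measurable_Zset. Qed.

Let mk : measurable_fun setT k.
Proof.
have mE : measurable E by exact: measurable_WZ.
have mf : measurable_fun E (fun q => (G q.1 q.2)%:E).
  by apply/measurable_EFinP; exact: measurable_fun_WZ.
exact: (measurable_restrictT _ mE).1 mf.
Qed.

Let k0 q : 0 <= k q.
Proof. by rewrite /k patchE; case: ifPn => // /[!inE] -[Wq Zq]; rewrite lee_fin G0. Qed.

(* P is only controlled on W; extending it by the zero measure makes it a finite
   kernel on the whole space. *)
Let P' (w : BV R n) : {measure set (BZ R d3) -> \bar R} :=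
  if w \in (W : set (BV R n)) then P w else mzero.

Let mP' U : measurable U -> measurable_fun setT (P' ^~ U).
Proof.
case: dP => _ mP _ mU.
apply: (eq_measurable_fun ((fun w => P w U) \_ (W : set (BV R n)))).
  by move=> w _; rewrite patchE /P'; case: ifPn.
exact: (measurable_restrictT _ mW).1 (mP U mU).
Qed.

Let uP' : measure_fam_uub P'.
Proof.
(* The uniform bound must be strict, while the mass is 1 on [W]. *)
exists 2%R => w; rewrite /P'; case: ifPn => [|_]; last by rewrite lte_fin.
by rewrite inE => Ww; case: dP => /(_ w Ww)[-> _] _ _; rewrite lte_fin ltr1n.
Qed.

HB.instance Definition _ := isKernel.Build _ _ _ _ R P' mP'.
HB.instance Definition _ := Kernel_isFinite.Build _ _ _ _ R P' uP'.

Let mG w : W w -> measurable_fun (Zset Z0 : set (BZ R d3)) (EFin \o G w).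
Proof. by move=> Ww; apply/measurable_EFinP; exact: measurable_fun_sectionZ cG Ww. Qed.

(** Disintegration writes the integral as the [m]-integral of nonnegative inner integrals, which
    therefore vanish for almost every [w]. The same argument under [P w] makes [G w] vanish almost
    surely. *)
Lemma disintegration_ae_zero :
  \int[al]_(q in E) (G q.1 q.2)%:E = 0 ->
  {ae m, forall w : BV R n, W w -> P w [set z | Zset Z0 z /\ G w z = 0%R] = 1}.
Proof.
case: dP => P1 mP -> //.
(* This is where the finite kernel [P'] and the zero extension [k] of [G] are used: they make the
   inner integral measurable in [w]. *)
have mh : measurable_fun setT (fun w => \int[P' w]_z k (w, z)).
  exact: measurable_fun_integral_finite_kernel.
have hE w : W w -> \int[P' w]_z k (w, z) = \int[P w]_(z in Zset Z0) (G w z)%:E.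
  move=> Ww; rewrite [RHS]integral_mkcond /P' ifT ?inE//; apply: eq_integral => z _.
  rewrite /k !patchE; congr (if _ then _ else _).
  by apply/idP/idP; rewrite !inE // => -[].
move=> al0.
have h0 : \int[m]_(w in (W : set (BV R n))) `|\int[P' w]_z k (w, z)| = 0.
  rewrite -al0; apply: eq_integral => w /[!inE] Ww.
  by rewrite -hE// gee0_abs//; apply: integral_ge0 => z _; exact: k0.
move/(ae_eq_integral_abs _ mW (measurable_funTS mh)) : h0.
apply: filterS => w /[swap] Ww /(_ Ww); rewrite /cst hE// => Gw0.
have [PT PZ] := P1 w Ww.
have mS : measurable ([set z | Zset Z0 z /\ G w z = 0%R] : set (BZ R d3)).
  rewrite (_ : mkset _ = Zset Z0 `&` (EFin \o G w) @^-1` [set 0]).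
    exact: (mG Ww mZ (emeasurable_set1 _)).
  by apply/seteqP; split=> z [Zz] /=; [move=> ->|case].
(* The mass 1 splits over the zero set of [G w] and its complement; it remains to see that the
   complement is negligible. *)
rewrite -PT -[in RHS](setUv [set z | Zset Z0 z /\ G w z = 0%R]) measureU//; last 2 first.
- exact: measurableC.
- exact: setICr.
rewrite [X in _ + X]measure_negligible ?adde0//; first exact: measurableC.
have /(ae_eq_integral_abs _ mZ (mG Ww)) :
    \int[P w]_(z in (Zset Z0 : set (BZ R d3))) `|(EFin \o G w) z| = 0.
  rewrite -Gw0; apply: eq_integral => z /[!inE] Zz.
  by rewrite gee0_abs//= lee_fin G0.
have nZ : (P w).-negligible (~` Zset Z0).
  by apply/negligibleP => //; exact: measurableC.
(* A point outside the zero set is either off [Zset Z0] or in it with [G w] nonzero; both cases are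
   negligible. *)
move=> /(negligibleU nZ); apply: negligibleS => z /= nS.
have [Zz|] := pselect (Zset Z0 z); last by left.
by right=> Gz; apply: nS; split => //; have [] := Gz Zz.
Qed.

End kernel.

(** * Transfer of integrals to image measures *)

Lemma integral_image {R : realType} {d d'} {T : measurableType d}
    {T' : measurableType d'} {mu : {measure set T -> \bar R}} {E : set T}
    {phi : T -> T'} {D : set T'} {f : T' -> R} :
  (mu setT < +oo)%E -> measurable E -> mu (~` E) = 0%E ->
  measurable_fun setT phi -> measurable D ->
  measurable_fun D f -> (exists M, forall y, D y -> `|f y| <= M) ->
  (forall x, E x -> ~ D (phi x) -> f (phi x) = 0) ->
  (\int[mu]_(x in E) (f (phi x))%:E = \int[pushforward mu phi]_(y in D) (f y)%:E)%E.
Proof.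
move=> muT mE E0 mphi mD mf [M fM] fD0.
have mfD : measurable_fun setT (f \_ D) by exact: (measurable_restrictT _ mD).1 mf.
have ifD : mu.-integrable (phi @^-1` setT) (EFin \o ((f \_ D) \o phi)).
  rewrite preimage_setT; apply: measurable_bounded_integrable => //.
  - exact: measurableT_comp.
  (* [M] may be negative when [D] is empty, and the bound must also cover the value 0 taken off
     [D]. *)
  - exists `|M|; split; first exact: num_real.
    move=> N MN x _ /=; rewrite patchE; case: ifPn => [/[!inE] Dx|_].
      by rewrite (le_trans (fM _ Dx))// (le_trans (ler_norm _))// ltW.
    by rewrite normr0 (le_trans _ (ltW MN)).
rewrite [RHS]integral_mkcond.
rewrite (_ : _ \_ D = EFin \o (f \_ D)); last by rewrite restrict_EFin.
rewrite (integral_pushforward mphi)//; last exact/measurable_EFinP.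
(* The complement of [E] is null, so the integral is cut down to [E]; there the points sent outside
   [D] have value 0 on both sides. *)
rewrite preimage_setT [in RHS](negligible_integral (measurableC mE))//.
rewrite setDE setCK setTI; apply: eq_integral => x /[!inE] Ex /=.
by rewrite patchE; case: ifPn => //; rewrite notin_setE => /(fD0 _ Ex) ->.
Qed.

(** The two image measures need only agree inside [D]. This covers both the marginal condition ([D]
    = [W]) and market clearing ([D] = the copy of [Z0]). *)
Lemma Rintegral_image {R : realType} {d1 d2 d'} {T1 : measurableType d1}
    {T2 : measurableType d2} {T' : measurableType d'}
    {mu1 : {measure set T1 -> \bar R}} {mu2 : {measure set T2 -> \bar R}}
    {E1 : set T1} {E2 : set T2} {phi1 : T1 -> T'} {phi2 : T2 -> T'}
    {D : set T'} {f : T' -> R} :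
  (mu1 setT < +oo)%E -> (mu2 setT < +oo)%E -> measurable E1 -> measurable E2 ->
  mu1 (~` E1) = 0%E -> mu2 (~` E2) = 0%E ->
  measurable_fun setT phi1 -> measurable_fun setT phi2 -> measurable D ->
  measurable_fun D f -> (exists M, forall y, D y -> `|f y| <= M) ->
  (forall x, E1 x -> ~ D (phi1 x) -> f (phi1 x) = 0) ->
  (forall x, E2 x -> ~ D (phi2 x) -> f (phi2 x) = 0) ->
  (forall A, measurable A -> A `<=` D -> mu1 (phi1 @^-1` A) = mu2 (phi2 @^-1` A)) ->
  \int[mu1]_(x in E1) f (phi1 x) = \int[mu2]_(x in E2) f (phi2 x).
Proof.
move=> mu1T mu2T mE1 mE2 E10 E20 mphi1 mphi2 mD mf fM f10 f20 mu12; congr fine.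
rewrite (integral_image mu1T mE1 E10 mphi1 mD mf fM f10).
rewrite (integral_image mu2T mE2 E20 mphi2 mD mf fM f20).
exact: eq_measure_integral.
Qed.

(** * Integrals against demand and supply distributions *)

Section distributions.
Context {R : realType} (n d3 : nat) (W : set 'rV[R]_n) (Z0 : set 'rV[R]_d3).
Hypotheses (cW : compact W) (cZ0 : compact Z0).
Variables (m : {measure set (BV R n) -> \bar R})
  (al : {measure set (BV R n * BZ R d3)%type -> \bar R})
  (F : 'rV[R]_n -> ZT R d3 -> R).
Hypotheses (mfin : (m setT < +oo)%E)
  (alF : assoc_distribution W (argmaxZ Z0 F) m al).

Let E : set (BV R n * BZ R d3) := W `*` Zset Z0.
Let mE : measurable E. Proof. exact: measurable_WZ. Qed.

Lemma assoc_distribution_setT : (al setT < +oo)%E.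
Proof. by case: alF => _ alm; rewrite -setXTT alm. Qed.

Lemma assoc_distribution_null : al (~` E) = 0%E.
Proof.
case: alF => -[A mA [AF A0]] _; apply/eqP; rewrite -measure_le0 -A0.
rewrite le_measure ?inE//; [exact: measurableC|exact: measurableC|].
by apply: subsetC => q /AF[Wq [Zq _]].
Qed.

Lemma integrable_WZ G : continuous_on_WZ W Z0 G ->
  al.-integrable E (EFin \o (fun q => G q.1 q.2)).
Proof.
move=> cG; apply: measurable_bounded_integrable => //.
- by apply: le_lt_trans assoc_distribution_setT; rewrite le_measure ?inE.
- exact: measurable_fun_WZ.
- have [M GM] := continuous_on_WZ_bounded cW cZ0 cG.
  exists `|M|; split; first exact: num_real.
  move=> N MN q [Wq Zq] /=.
  by rewrite (le_trans (GM _ _ Wq Zq))// (le_trans (ler_norm _))// ltW.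
Qed.

(** The marginal condition says that [m] is the image of [al] under the first projection. *)
Lemma Rintegral_fst (f : 'rV[R]_n -> R) : m (~` (W : set (BV R n))) = 0%E ->
  {within W, continuous f} ->
  \int[al]_(q in E) f q.1 = \int[m]_(w in (W : set (BV R n))) f w.
Proof.
move=> mW0 cf; have mW : measurable (W : set (BV R n)) by exact: compact_measurableBV.
apply: (Rintegral_image (phi2 := id) (f := f : BV R n -> R)
  assoc_distribution_setT mfin mE mW
  assoc_distribution_null mW0 measurable_fst (@measurable_id _ _ setT) mW).
- exact: continuous_measurable_fun_BV.
- exact: compact_continuous_bounded cf.
- by move=> q [].
- by [].
- move=> A mA _; case: alF => _ <- //; congr (al _).
  by apply/seteqP; split=> [q|q []].
Qed.

End distributions.

(** The marginals on goods may differ at the two empty goods, but [p] vanishes there, so market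
    clearing on [Z0] suffices. *)
Lemma Rintegral_snd {R : realType} {n1 n2 d3 : nat}
    {W1 : set 'rV[R]_n1} {W2 : set 'rV[R]_n2} {Z0 : set 'rV[R]_d3}
    {al : {measure set (BV R n1 * BZ R d3)%type -> \bar R}}
    {be : {measure set (BV R n2 * BZ R d3)%type -> \bar R}} {p : ZT R d3 -> R} :
  compact W1 -> compact W2 -> compact Z0 ->
  (al setT < +oo)%E -> (be setT < +oo)%E ->
  al (~` (W1 `*` Zset Z0)) = 0%E -> be (~` (W2 `*` Zset Z0)) = 0%E ->
  (forall A : set (BZ R d3), measurable A -> A `<=` inl @` Z0 ->
     al (setT `*` A) = be (setT `*` A)) ->
  price_system Z0 p ->
  \int[al]_(q in (W1 `*` Zset Z0 : set (BV R n1 * BZ R d3))) p q.2 =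
  \int[be]_(q in (W2 `*` Zset Z0 : set (BV R n2 * BZ R d3))) p q.2.
Proof.
move=> cW1 cW2 cZ0 alT beT al0 be0 albe [cp [pd ps]].
have c0 : compact [set 0 : 'rV[R]_n1] by exact: compact_set1.
(* p is viewed as a function on {0} x Z in order to reuse the results on W x Z. *)
have cp0 := continuous_on_WZ_snd [set 0 : 'rV[R]_n1] cp.
have mI : measurable (inl @` Z0 : set (BZ R d3)) by exact: compact_measurable_inl.
have mZ : measurable (Zset Z0 : set (BZ R d3)) by exact: compact_measurable_Zset.
have IZ : inl @` Z0 `<=` Zset Z0 by move=> _ [z Zz <-].
have p0 z : Zset Z0 z -> ~ (inl @` Z0) z -> p z = 0.
  by case: z => [z|[]] //= Zz []; exists z.
apply: (Rintegral_image (f := p : BZ R d3 -> R)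
  alT beT (measurable_WZ cW1 cZ0) (measurable_WZ cW2 cZ0)
  al0 be0 measurable_snd measurable_snd mI).
- by apply: (measurable_funS mZ IZ); exact: measurable_fun_sectionZ c0 cZ0 _ 0 cp0 erefl.
- have [M pM] := continuous_on_WZ_bounded c0 cZ0 cp0.
  by exists M => z /IZ; exact: (pM 0).
- by move=> q [_ ?]; exact: p0.
- by move=> q [_ ?]; exact: p0.
- by move=> A mA /(albe A mA); rewrite -!setTX.
Qed.

(** * Gap between maximal payoffs and those of an allocation *)

Section gap.
Context {R : realType} (n d3 : nat) (W : set 'rV[R]_n) (Z0 : set 'rV[R]_d3).
Hypotheses (cW : compact W) (cZ0 : compact Z0).
Variable m : {measure set (BV R n) -> \bar R}.
Hypotheses (mfin : (m setT < +oo)%E) (m0 : m (~` (W : set (BV R n))) = 0%E).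
Implicit Types (al : {measure set (BV R n * BZ R d3)%type -> \bar R})
  (F G : 'rV[R]_n -> ZT R d3 -> R) (p : ZT R d3 -> R).

(** Total payoff lost under the allocation [al] when agents have net utility [F]. *)
Definition gap F al : R :=
  \int[al]_(q in (W `*` Zset Z0 : set (BV R n * BZ R d3))) (supZ Z0 F q.1 - F q.1 q.2).

Lemma gap_ge0 F al : continuous_on_WZ W Z0 F -> 0 <= gap F al.
Proof.
move=> cF; apply: Rintegral_ge0 => q [Wq Zq].
by rewrite subr_ge0; exact: le_supZ cF _ _ _ _.
Qed.

Lemma gap_eq0 F al : continuous_on_WZ W Z0 F ->
  assoc_distribution W (argmaxZ Z0 F) m al -> gap F al = 0.
Proof.
move=> cF alF; have cgap := continuous_on_WZ_gap cW cZ0 cF.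
have iF := integrable_WZ cW cZ0 mfin alF cgap.
have mE := measurable_WZ cW cZ0.
case: alF => -[A mA [AF A0]] _.
(* Up to a null set the integral is over [A], where every choice is optimal and the integrand is
   0. *)
rewrite /gap /Rintegral (negligible_integral (measurableC mA))// setDE setCK.
rewrite integral0_eq// => q [_ /AF[Wq]].
by rewrite (argmaxZE cW cZ0 cF)// => -[_ ->].
Qed.

(** [F] carries the prices that [al] is associated with, whereas [p] may come from another
    equilibrium; the comparison rests on this decoupling. *)
Lemma gapE c p F al : continuous_on_WZ W Z0 c -> price_system Z0 p ->
  continuous_on_WZ W Z0 F ->
  assoc_distribution W (argmaxZ Z0 F) m al ->
  gap (fun w z => c w z - p z) al =
  \int[m]_(w in (W : set (BV R n))) supZ Z0 (fun w z => c w z - p z) w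
  - \int[al]_(q in (W `*` Zset Z0 : set (BV R n * BZ R d3))) c q.1 q.2
  + \int[al]_(q in (W `*` Zset Z0 : set (BV R n * BZ R d3))) p q.2.
Proof.
move=> cc pp cF alF; have cp := continuous_on_WZ_snd W pp.1.
have cB := continuous_on_WZB cc cp.
have csup := continuous_supZ cW cZ0 cB.
rewrite -(Rintegral_fst cW cZ0 mfin alF m0 csup).
have mE := measurable_WZ cW cZ0.
have iG G cG := @integrable_WZ _ _ _ _ _ cW cZ0 _ _ _ mfin alF G cG.
rewrite /gap RintegralB//; last 2 first.
- exact: (iG _ (continuous_on_WZ_fst _ csup)).
- exact: iG cB.
rewrite RintegralB//; last 2 first.
- exact: iG cc.
- exact: iG cp.
by rewrite opprB addrA addrAC.
Qed.

Lemma gap_eq0_ae F F' al P : continuous_on_WZ W Z0 F ->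
  assoc_distribution W (argmaxZ Z0 F') m al -> disintegration W Z0 m al P ->
  gap F al = 0 ->
  {ae m, forall w : BV R n, W w -> P w (argmaxZ Z0 F w) = 1%E}.
Proof.
move=> cF alF' dP gap0; have cgap := continuous_on_WZ_gap cW cZ0 cF.
have mE := measurable_WZ cW cZ0.
have igap := integrable_fin_num mE (integrable_WZ cW cZ0 mfin alF' cgap).
have gap_nneg w z : W w -> Zset Z0 z -> 0 <= supZ Z0 F w - F w z.
  by move=> Ww Zz; rewrite subr_ge0; exact: le_supZ cF _ _ _ _.
have := disintegration_ae_zero cW cZ0 cgap gap_nneg dP.
rewrite -[X in (X = _ -> _) -> _]fineK// => /(_ (congr1 EFin gap0)).
by apply: filterS => w + Ww => /(_ Ww); rewrite (argmaxZE cW cZ0 cF).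
Qed.

End gap.

(** * Buyers and sellers in a common form *)

Section equilibria.
Context {R : realType} (d1 d2 d3 : nat) (X : set 'rV[R]_d1) (Y : set 'rV[R]_d2)
  (Z0 : set 'rV[R]_d3) (mu : {measure set (BV R d1) -> \bar R})
  (nu : {measure set (BV R d2) -> \bar R})
  (u : 'rV[R]_d1 -> 'rV[R]_d3 -> R) (v : 'rV[R]_d2 -> 'rV[R]_d3 -> R).

Lemma continuous_on_WZ_uZ : regular_utility X Z0 u -> continuous_on_WZ X Z0 (uZ u).
Proof.
move=> [V [_ XV cV _ _]]; split; first exact: continuous_subspaceW cV.
by case; apply: continuous_subspaceT; exact: cst_continuous.
Qed.

Lemma continuous_on_WZ_NvZ : regular_utility Y Z0 v ->
  continuous_on_WZ Y Z0 (fun y z => - vZ v y z).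
Proof.
move=> [V [_ YV cV _ _]]; split.
  by move=> q; apply: continuousN; exact: (continuous_subspaceW YV cV).
by case; apply: continuous_subspaceT => y; apply: continuousN; exact: cst_continuous.
Qed.

Lemma SmapE p y : Smap Z0 v p y = argmaxZ Z0 (fun y z => - vZ v y z - - p z) y.
Proof.
by apply/seteqP; split=> z [Zz zP]; split => // z' /zP; rewrite -!opprD lerN2.
Qed.

Lemma price_systemN (p : ZT R d3 -> R) :
  price_system Z0 p -> price_system Z0 (fun z => - p z).
Proof.
move=> [cp [pd ps]]; split; last by rewrite pd ps oppr0.
by move=> z; apply: continuousN; exact: cp.
Qed.

End equilibria.

(** * Comparison of the two equilibria *)

Theorem theorem12 (R : realType) (d1 d2 d3 : nat)
  (X : set 'rV[R]_d1) (Y : set 'rV[R]_d2) (Z0 : set 'rV[R]_d3)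
  (mu : {measure set (BV R d1) -> \bar R})
  (nu : {measure set (BV R d2) -> \bar R})
  (u : 'rV[R]_d1 -> 'rV[R]_d3 -> R) (v : 'rV[R]_d2 -> 'rV[R]_d3 -> R) :
  standing_setting X Y Z0 mu nu u v ->
  forall (p1 p2 : ZT R d3 -> R)
    (al1 al2 : {measure set (BV R d1 * BZ R d3)%type -> \bar R})
    (be1 be2 : {measure set (BV R d2 * BZ R d3)%type -> \bar R}),
  equilibrium X Y Z0 u v mu nu p1 al1 be1 ->
  equilibrium X Y Z0 u v mu nu p2 al2 be2 ->
  forall (P1x P2x : 'rV[R]_d1 -> {measure set (BZ R d3) -> \bar R})
    (P1y P2y : 'rV[R]_d2 -> {measure set (BZ R d3) -> \bar R}),
  disintegration X Z0 mu al1 P1x ->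
  disintegration Y Z0 nu be1 P1y ->
  disintegration X Z0 mu al2 P2x ->
  disintegration Y Z0 nu be2 P2y ->
  {ae mu, forall x : BV R d1, X x ->
     P2x x (Dmap Z0 u p1 x) = 1%E /\ P1x x (Dmap Z0 u p1 x) = 1%E} /\
  {ae nu, forall y : BV R d2, Y y ->
     P2y y (Smap Z0 v p1 y) = 1%E /\ P1y y (Smap Z0 v p1 y) = 1%E}.
Proof.
move=> [[cX [cY cZ]] [muT muX] [nuT nuY] ru rv] p1 p2 al1 al2 be1 be2.
move=> [[pp1 _] al1D be1S albe1] [[pp2 _] al2D be2S albe2] P1x P2x P1y P2y.
move=> dP1x dP1y dP2x dP2y.
pose Fx p := fun x z => uZ u x z - p z.
pose Fy p := fun y z => - vZ v y z - - p z.
have cu := continuous_on_WZ_uZ ru; have cv := continuous_on_WZ_NvZ rv.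
have cFx p : price_system Z0 p -> continuous_on_WZ X Z0 (Fx p).
  by move=> pp; apply: continuous_on_WZB cu (continuous_on_WZ_snd X pp.1).
have cFy p : price_system Z0 p -> continuous_on_WZ Y Z0 (Fy p).
  by move=> /price_systemN pp; apply: continuous_on_WZB cv (continuous_on_WZ_snd Y pp.1).
have SE p : Smap Z0 v p = argmaxZ Z0 (Fy p) by apply/funext => y; exact: SmapE.
(* Only the supply side is rewritten: demand already has the form [argmaxZ] of [Fx] by
   conversion. *)
rewrite !SE in be1S be2S *.
(* The right-hand side separates into a part depending on [p] alone and a part depending on the
   allocation alone: the price integrals enter with opposite signs for buyers and sellers and cancel
   by [Rintegral_snd]. *)
have total p al be q : price_system Z0 p -> price_system Z0 q ->
    assoc_distribution X (argmaxZ Z0 (Fx q)) mu al ->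
    assoc_distribution Y (argmaxZ Z0 (Fy q)) nu be ->
    (forall A : set (BZ R d3), measurable A -> A `<=` inl @` Z0 ->
        al (setT `*` A) = be (setT `*` A)) ->
  gap X Z0 (Fx p) al + gap Y Z0 (Fy p) be =
  \int[mu]_(x in (X : set (BV R d1))) supZ Z0 (Fx p) x
  + \int[nu]_(y in (Y : set (BV R d2))) supZ Z0 (Fy p) y
  - \int[al]_(t in (X `*` Zset Z0 : set (BV R d1 * BZ R d3))) uZ u t.1 t.2
  - \int[be]_(t in (Y `*` Zset Z0 : set (BV R d2 * BZ R d3))) (- vZ v t.1 t.2).
  move=> pp pq alq beq albe.
  have ppN := price_systemN pp.
  rewrite /Fx (gapE cX cZ muT muX cu pp (cFx _ pq) alq).
  rewrite /Fy (gapE cY cZ nuT nuY cv ppN (cFy _ pq) beq).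
  rewrite (Rintegral_snd cX cY cZ (assoc_distribution_setT muT alq)
    (assoc_distribution_setT nuT beq) (assoc_distribution_null cX cZ alq)
    (assoc_distribution_null cY cZ beq) albe pp).
  have -> : \int[be]_(q0 in (Y `*` Zset Z0 : set (BV R d2 * BZ R d3))) (- p q0.2) =
     - \int[be]_(q0 in (Y `*` Zset Z0 : set (BV R d2 * BZ R d3))) p q0.2.
    have ip := integrable_WZ cY cZ nuT beq (continuous_on_WZ_snd Y pp.1).
    rewrite -mulN1r -(RintegralZl (-1) (measurable_WZ cY cZ) ip).
    by apply: eq_Rintegral => t _; rewrite mulN1r.
  lra.
(* The first index refers to the prices, the second to the allocation. By separation, [t12] and
   [t21] have the same total as [t11] and [t22]. *)
have t11 := total _ _ _ _ pp1 pp1 al1D be1S albe1.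
have t12 := total _ _ _ _ pp1 pp2 al2D be2S albe2.
have t21 := total _ _ _ _ pp2 pp1 al1D be1S albe1.
have t22 := total _ _ _ _ pp2 pp2 al2D be2S albe2.
have gx11 := gap_eq0 cX cZ muT (cFx _ pp1) al1D.
have gy11 := gap_eq0 cY cZ nuT (cFy _ pp1) be1S.
have gx22 := gap_eq0 cX cZ muT (cFx _ pp2) al2D.
have gy22 := gap_eq0 cY cZ nuT (cFy _ pp2) be2S.
have gx12 := gap_ge0 cX cZ al2 (cFx _ pp1).
have gy12 := gap_ge0 cY cZ be2 (cFy _ pp1).
have gx21 := gap_ge0 cX cZ al1 (cFx _ pp2).
have gy21 := gap_ge0 cY cZ be1 (cFy _ pp2).
(* The own gaps are 0, so the four cross gaps sum to 0; being nonnegative, each vanishes. *)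
have ex12 : gap X Z0 (Fx p1) al2 = 0 by lra.
have ey12 : gap Y Z0 (Fy p1) be2 = 0 by lra.
split.
  have := gap_eq0_ae cX cZ muT (cFx _ pp1) al1D dP1x gx11.
  have := gap_eq0_ae cX cZ muT (cFx _ pp1) al2D dP2x ex12.
  by apply: filterS2 => x P2 P1 Xx; split; [exact: P2|exact: P1].
have := gap_eq0_ae cY cZ nuT (cFy _ pp1) be1S dP1y gy11.
have := gap_eq0_ae cY cZ nuT (cFy _ pp1) be2S dP2y ey12.
by apply: filterS2 => y P2 P1 Yy; split; [exact: P2|exact: P1].
Qed.
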